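(* Assume that the solvency sets $(\mathbf{K}_t)_{t=0,\dots,T}$ are strictly proper and that (NA$^s$) holds, i.e. $\mathsf{A}_{0,t}\cap L^0(\mathbf{K}_t,\mathcal{F}_t)\subseteq L^0(\mathbf{K}_t^0,\mathcal{F}_t)$ for all $t=0,\dots,T$. Let $\xi\in L^0(\mathbb{R}^d,\mathcal{F}_T)$. Then $\Xi_t^\xi=L^0(\mathbf{X}_t^\xi,\mathcal{F}_t)$ for $t=0,\dots,T$, where $\mathbf{X}_t^\xi$ are $\mathcal{F}_t$-measurable random closed convex sets given by $\mathbf{X}_T^\xi=\xi+\mathbf{K}_T$ and $$\mathbf{X}_t^\xi=\mathbf{K}_t+\mathrm{m}(\mathbf{X}_{t+1}^\xi|\mathcal{F}_t),\qquad t=T-1,\dots,0.$$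
   Context: $(\Omega,\mathcal{F},(\mathcal{F}_t)_{t=0,\dots,T},\mathbb{P})$ is a filtered complete probability space with $\mathcal{F}_0$ trivial. $L^0(\Gamma,\mathcal{F}_t)$ is the family of $\mathcal{F}_t$-measurable random vectors a.s. in $\Gamma$. Solvency sets: $\mathbf{K}_t$ is an $\mathcal{F}_t$-measurable random closed convex set in $\mathbb{R}^d$ with $\mathbf{K}_t+\mathbb{R}^d_+\subseteq\mathbf{K}_t$ and $\mathbf{K}_t\cap\mathbb{R}^d_-=\{0\}$ a.s.; $\mathbf{K}_t^0=\bigcap_{c\in\mathbb{Q}\setminus\{0\}}c\mathbf{K}_t$; strictly proper means $\mathbf{K}_t\cap(-\mathbf{K}_t)=\{0\}$ a.s. for all $t$. $\mathsf{A}_{t,s}=\sum_{u=t}^sL^0(-\mathbf{K}_u,\mathcal{F}_u)$. Superhedging sets of $\xi$: $\Xi_T^\xi=L^0(\xi+\mathbf{K}_T,\mathcal{F}_T)$ and $\Xi_t^\xi=L^0(\mathbf{K}_t,\mathcal{F}_t)+(\Xi_{t+1}^\xi\cap L^0(\mathbb{R}^d,\mathcal{F}_t))$ for $t=T-1,\dots,0$. $\mathrm{m}(\mathbf{X}|\mathcal{F}_t)$ (conditional core) is the largest $\mathcal{F}_t$-measurable random set a.s. contained in $\mathbf{X}$. *)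

(* Defs.v *)
From HB Require Import structures.
From mathcomp Require Import all_boot all_order all_algebra.
From mathcomp Require Import all_classical all_reals all_analysis.
Set Implicit Arguments. Unset Strict Implicit. Unset Printing Implicit Defensive.
Import Order.TTheory GRing.Theory Num.Theory.
Import numFieldNormedType.Exports.
Local Open Scope classical_set_scope.
Local Open Scope ring_scope.

Section VecDefs.
Context (R : realType) (d : nat).
Notation V := 'rV[R]_d.

Definition convex_set (S : set V) : Prop :=
  forall x y (l : R), S x -> S y -> 0 <= l -> l <= 1 -> S (l *: x + (1 - l) *: y).

Definition minksum (A B : set V) : set V := [set x + y | x in A & y in B].

Definition Kzero (K : set V) : set V :=
  [set x | forall c : rat, c != 0 -> exists2 y, K y & x = ratr c *: y].

Definition nonneg_orthant : set V := [set x | forall i, 0 <= x ord0 i].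
Definition nonpos_orthant : set V := [set x | forall i, x ord0 i <= 0].
Definition negset (K : set V) : set V := [set x | K (- x)].

End VecDefs.

Section Defs.
Context (dsp : measure_display) (Omega : measurableType dsp) (R : realType) (d : nat).
Notation V := 'rV[R]_d.

Definition Gmeas (G : set (set Omega)) (f : Omega -> V) : Prop :=
  forall (i : 'I_d) (B : set R), measurable B ->
    G ((fun w => f w ord0 i) @^-1` B).

Definition L0 (P : probability Omega R) (G : set (set Omega)) (Gam : Omega -> set V)
  : set (Omega -> V) :=
  [set f | Gmeas G f /\ {ae P, forall w, Gam w (f w)}].

Definition rand_closed_set (G : set (set Omega)) (X : Omega -> set V) : Prop :=
  (forall w, closed (X w)) /\
  (forall U : set V, open U -> G [set w | X w `&` U !=set0]).

Definition rand_closed_convex_set (G : set (set Omega)) (X : Omega -> set V) : Prop :=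
  rand_closed_set G X /\ (forall w, convex_set (X w)).

Definition as_subset (P : probability Omega R) (X Y : Omega -> set V) : Prop :=
  {ae P, forall w, X w `<=` Y w}.

Definition is_ccore (P : probability Omega R) (G : set (set Omega))
    (X M : Omega -> set V) : Prop :=
  rand_closed_set G M /\ as_subset P M X /\
  (forall Y, rand_closed_set G Y -> as_subset P Y X -> as_subset P Y M).

Definition fsum (A B : set (Omega -> V)) : set (Omega -> V) :=
  [set f | exists2 g, A g & exists2 h, B h & f = (fun w => g w + h w)].

Definition Aset (P : probability Omega R) (F : nat -> set (set Omega))
    (K : nat -> Omega -> set V) (t s : nat) : set (Omega -> V) :=
  [set f | exists z : nat -> Omega -> V,
     (forall u, (t <= u <= s)%N -> L0 P (F u) (fun w => negset (K u w)) (z u)) /\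
     f = (fun w => \sum_(t <= u < s.+1) z u w)].

(* superhedging sets: Xi_rev k = Xi_{T-k}, defined by backward recursion *)
Fixpoint Xi_rev (P : probability Omega R) (F : nat -> set (set Omega))
    (K : nat -> Omega -> set V) (T : nat) (xi : Omega -> V) (k : nat)
    : set (Omega -> V) :=
  match k with
  | 0%N => L0 P (F T) (fun w => [set xi w + k | k in K T w])
  | k'.+1 => fsum (L0 P (F (T - k)%N) (K (T - k)%N))
                  (Xi_rev P F K T xi k' `&` L0 P (F (T - k)%N) (fun _ => setT))
  end.

Definition Xi P F K T xi (t : nat) := Xi_rev P F K T xi (T - t)%N.

End Defs.

(* Main.v *)
Require Import Defs.
From HB Require Import structures.
From mathcomp Require Import all_boot all_order all_algebra.
From mathcomp Require Import all_classical all_reals all_analysis.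
From mathcomp Require Import measurable_realfun.
Import Order.TTheory GRing.Theory Num.Theory.
Import numFieldNormedType.Exports.
Local Open Scope classical_set_scope.
Local Open Scope ring_scope.
Set Implicit Arguments. Unset Strict Implicit. Unset Printing Implicit Defensive.

(** The argument goes backwards in time. The conditional core [M] of [X_{t+1}] is obtained by
    exhaustion, and measurable selection gives [L^0(K_t) + L^0(M) = L^0(K_t + M)], so everything
    rests on [K_t + M] being closed. That sum of closed convex sets is closed unless some [v <> 0]
    lies in the recession cone of [K_t] while [-v] lies in that of [M]. Recession directions of
    [X_{t+1}] split, measurably, into trades [k_{t+1} + ... + k_T] with [k_u] in [K_u]; hence a
    measurable choice of such a [v] would give trades [k_t, ..., k_T] summing to zero, and the
    no-arbitrage condition with strict properness forces [k_T = 0], then [k_{T-1} = 0], and so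
    on down to [v = k_t = 0]. *)

(** * Recession cones *)

(** A solvency set need not be a cone, so unbounded behaviour is visible only through its recession
    directions. The backward induction therefore carries, beside closedness, a second property,
    [rec_decomposable]: every measurable recession direction of the superhedging set is almost
    surely a sum of adapted trades. The condition that yields closedness also propagates this
    property: without a common line, a recession direction of [K t + M] splits into recession
    directions of the two summands, and the first part is a genuine trade because [K t] contains 0.
    Measurability is expressed by the events of hitting open sets. They behave well under continuous
    images and countable unions but say nothing directly about intersections; these are reached as
    decreasing limits, where compactness of bounded sets is essential. *)

Section RecessionCone.
Context {R : realType} {d : nat}.
Notation V := 'rV[R]_d.
Implicit Types (X K M : set V) (u v x : V).

(* The disjunct [v = 0] makes the recession cone of the empty set trivial. *)
Definition reccone X : set V :=
  [set v | v = 0 \/ X !=set0 /\ forall x (s : R), X x -> 0 <= s -> X (x + s *: v)].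

Lemma cvg_to_eq (G : set_system nat) (u : nat -> V) (l l' : V) :
  l = l' -> u @ G --> l -> u @ G --> l'.
Proof. by move=> ->. Qed.

(** Replaces the extraction of convergent subsequences: one ultrafilter serves all bounded sequences
    at once, with no further extraction. *)
Lemma ultra_bounded_cvg (G : set_system nat) (u : nat -> V) (C : R) :
  UltraFilter G -> (\forall n \near G, `|u n| <= C) -> exists l : V, u @ G --> l.
Proof.
move=> UG ubnd.
have cA : compact [set v : V | `|v| <= C].
  apply: bounded_closed_compact.
    by exists C; split; rewrite ?num_real// => y Cy x /= xC; apply: le_trans xC (ltW Cy).
  apply: (@closed_comp _ _ (fun v : V => `|v|) [set r : R | r <= C]).
    by move=> x _; exact: norm_continuous.
  exact: closed_le.
have [l [_ cl]] := cA (u @ G) _ ubnd.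
exists l => U lU.
have [//|GC] := in_ultra_setVsetC (u @^-1` U) UG.
have [y [/= ? ?]] := cl (~` U) U GC lU.
by [].
Qed.

Lemma ultrafilter_nat : exists G : set_system nat, UltraFilter G /\ \oo `<=` G.
Proof. exact: ultraFilterLemma. Qed.

(** For [y] in [X] and [l >= 0], the point [y + l *: v] is the limit of the convex combinations of
    [x n] and [y] with weight [l * s n] on [x n], a weight that is eventually below 1. *)
Lemma reccone_lim (G : set_system nat) X (x : nat -> V) (s : nat -> R) v :
  ProperFilter G -> closed X -> Defs.convex_set X -> (forall n, X (x n)) ->
  (forall n, 0 <= s n) -> s @ G --> (0 : R) ->
  (fun n => s n *: x n) @ G --> v -> reccone X v.
Proof.
move=> PG cX vX Xx s0 sl sxl; right; split; first by exists (x 0%N); exact: Xx.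
move=> y l Xy l0.
have lsl : (fun n => l * s n) @ G --> (0 : R).
  by rewrite -(mulr0 l); apply: cvgM => //; exact: cvg_cst.
apply: (@closed_cvg _ _ G _ (fun n => (l * s n) *: x n + (1 - l * s n) *: y) X cX).
  have : \forall n \near G, l * s n < 1.
    by move/cvgr_lt : lsl; apply; exact: ltr01.
  apply: filterS => n ls1. exact: vX (mulr_ge0 l0 (s0 n)) (ltW ls1).
rewrite addrC; apply: cvgD.
  under eq_fun do rewrite -scalerA.
  by apply: cvgZ => //; exact: cvg_cst.
have : (fun n => (1 - l * s n) *: y) @ G --> (1 - 0) *: y.
  by apply: cvgZr_tmp; apply: cvgB => //; exact: cvg_cst.
by rewrite subr0 scale1r.
Qed.

Lemma reccone_ray X x v : closed X -> Defs.convex_set X ->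
  (forall n : nat, X (x + n.+1%:R *: v)) -> reccone X v.
Proof.
move=> cX vX Xx.
apply: (@reccone_lim \oo X (fun n => x + n.+1%:R *: v) (fun n => n.+1%:R^-1)) => //.
  exact: cvg_harmonic.
under eq_fun => n.
  rewrite scalerDr scalerA mulVf ?pnatr_eq0// scale1r; over.
apply: (@cvg_to_eq _ _ (0 *: x + v)); first by rewrite scale0r add0r.
apply: cvgD; last exact: cvg_cst.
by apply: cvgZr_tmp; exact: cvg_harmonic.
Qed.

Lemma reccone_sub M X : M `<=` X -> closed X -> Defs.convex_set X ->
  reccone M `<=` reccone X.
Proof.
move=> MX cX vX v [->|[[m Mm] Mv]]; first by left.
by apply: (@reccone_ray _ m) => // n; apply/MX/Mv.
Qed.

Lemma closed_affine_preimage X x (s : R) : closed X -> closed [set v | X (x + s *: v)].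
Proof.
move=> cX; apply: (@preimage_closed _ _ (fun v : V => x + s *: v)) => // v _.
have h : (fun v : V => s *: v) @ v --> s *: v by exact: scaler_continuous.
by apply: (cvgD (cvg_cst x) h).
Qed.

Lemma reccone_closed X : closed X -> closed (reccone X).
Proof.
move=> cX; have [X0|X0] := pselect (X !=set0); last first.
  rewrite (_ : reccone X = [set 0]); last first.
    by apply/seteqP; split=> [v [->|[/X0]]|_ ->] //; left.
  exact: (@accessible_closed_set1 _ (hausdorff_accessible (@norm_hausdorff _ _))).
rewrite (_ : reccone X =
    \bigcap_(xs in [set xs : V * R | X xs.1 /\ 0 <= xs.2]) [set v | X (xs.1 + xs.2 *: v)]).
  by apply: closed_bigI => xs _; exact: closed_affine_preimage.
apply/seteqP; split => v.
  move=> [-> [x s] /= [Xx _]|[_ Xv] [x s] [Xx s0]]; last exact: Xv.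
  by rewrite scaler0 addr0.
by move=> h; right; split=> // x s Xx s0; exact: (h (x, s)).
Qed.

Lemma reccone_scale X v (a : R) : 0 <= a -> reccone X v -> reccone X (a *: v).
Proof.
move=> a0 [->|[X0 Xv]]; first by left; rewrite scaler0.
by right; split=> // x s Xx s0; rewrite scalerA; apply: Xv => //; exact: mulr_ge0.
Qed.

Lemma reccone_sub_self X : X 0 -> reccone X `<=` X.
Proof. by move=> X0 v [->//|[_ /(_ 0 1 X0 ler01)]]; rewrite add0r scale1r. Qed.

(** * Sums of closed convex sets without a common line *)

Definition no_common_line K M := forall v, reccone K v -> reccone M (- v) -> v = 0.

(** If [s n *: k n] were unbounded, normalising it would give a unit vector in the recession cone of
    [K]; the normalised sums tend to 0, so the opposite vector is in the recession cone of [M]. The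
    factor [s] allows two uses: [s = 1] for closedness of the sum, [s n = n.+1%:R^-1] for its
    recession directions. *)
Lemma scaled_sum_bounded (G : set_system nat) K M (k m : nat -> V) (s : nat -> R) (g : V) :
  UltraFilter G -> closed K -> Defs.convex_set K -> closed M -> Defs.convex_set M ->
  no_common_line K M ->
  (forall n, K (k n)) -> (forall n, M (m n)) -> (forall n, 0 <= s n <= 1) ->
  (fun n => s n *: (k n + m n)) @ G --> g ->
  exists C : R, \forall n \near G, `|s n *: k n| <= C.
Proof.
move=> UG cK vK cM vM KM Kk Mm s01 sg; apply: contrapT => /forallNP unb.
(* An ultrafilter decides every event, so a bound that fails along it is exceeded along it. *)
have unbG C : \forall n \near G, C < `|s n *: k n|.
  have [/unb//|] := in_ultra_setVsetC [set n | `|s n *: k n| <= C] UG.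
  by apply: filterS => n /= /negP; rewrite -ltNge.
pose a n := `|s n *: k n|^-1.
have a0 : a @ G --> (0 : R).
  apply/cvgrPdist_lt => e e0; near=> n.
  rewrite sub0r normrN ger0_norm ?invr_ge0//.
  have : e^-1 < `|s n *: k n| by near: n; exact: unbG.
  by move=> h; rewrite invf_plt// posrE (lt_trans _ h)// invr_gt0.
have as0 : (fun n => a n * s n) @ G --> (0 : R).
  apply: (@squeeze_cvgr _ _ _ _ (fun=> 0) a) => //; last exact: cvg_cst.
  near=> n; have /andP[sn0 sn1] := s01 n.
  by rewrite mulr_ge0 ?invr_ge0//= ler_piMr ?invr_ge0.
have nrm1 : \forall n \near G, `|(a n * s n) *: k n| = 1.
  near=> n; rewrite -scalerA normrZ ger0_norm ?invr_ge0// mulVf//.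
  by rewrite gt_eqF//; near: n; exact: unbG.
have [v vl] : exists l : V, (fun n => (a n * s n) *: k n) @ G --> l.
  by apply: (@ultra_bounded_cvg _ _ 1) => //; apply: filterS nrm1 => n ->.
have v1 : `|v| = 1.
  apply: (@closed_cvg _ _ G _ (fun n => `|(a n * s n) *: k n|) [set 1]).
  - exact: closed_eq.
  - by apply: filterS nrm1.
  - exact: cvg_norm.
have as_ge0 n : 0 <= a n * s n.
  by rewrite mulr_ge0 ?invr_ge0//; case/andP: (s01 n).
have Kv : reccone K v by exact: (reccone_lim _ cK vK Kk as_ge0 as0 vl).
have Mv : reccone M (- v).
  apply: (reccone_lim _ cM vM Mm as_ge0 as0).
  have : (fun n => a n *: (s n *: (k n + m n)) - (a n * s n) *: k n) @ G --> - v.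
    apply: (@cvg_to_eq _ _ (0 *: g - v)); first by rewrite scale0r add0r.
    by apply: cvgB => //; exact: cvgZ.
  apply: cvg_trans; apply: near_eq_cvg; apply: nearW => n /=.
  by rewrite scalerA scalerDr [_ + _ *: m n]addrC addrK.
by move: v1; rewrite (KM v)// normr0 => /esym/eqP; rewrite oner_eq0.
Unshelve. all: by end_near. Qed.

Lemma minksum_closed K M : closed K -> Defs.convex_set K -> closed M -> Defs.convex_set M ->
  no_common_line K M -> closed (minksum K M).
Proof.
move=> cK vK cM vM KM x clx.
have : forall n : nat, exists km : V * V,
    [/\ K km.1, M km.2 & ball x (n.+1%:R^-1) (km.1 + km.2)].
  move=> n; have [_ [[k Kk [m Mm <-]] xkm]] := clx _ (nbhsx_ballx x n.+1%:R^-1 ltac:(by [])).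
  by exists (k, m).
move=> /choice[f Hf].
have [G [UG ooG]] := ultrafilter_nat.
have fx : (fun n => (f n).1 + (f n).2) @ G --> x.
  apply: (@cvg_trans _ ((fun n => (f n).1 + (f n).2) @ \oo)); first by move=> A /ooG.
  apply/cvgrPdist_lt => e e0; near=> n.
  have [_ _] := Hf n; rewrite -ball_normE /= => /lt_trans; apply.
  by near: n; exact: near_infty_natSinv_lt (PosNum e0).
have [C kC] : exists C : R, \forall n \near G, `|1 *: (f n).1| <= C.
  apply: (@scaled_sum_bounded G K M _ (fun n => (f n).2) (fun=> 1) x) => //.
  - by move=> n; case: (Hf n).
  - by move=> n; case: (Hf n).
  - by move=> n; rewrite ler01 lexx.
  - by under eq_fun do rewrite scale1r.
have [k kl] : exists l : V, (fun n => (f n).1) @ G --> l.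
  by apply: (@ultra_bounded_cvg _ _ C) => //; apply: filterS kC => n; rewrite scale1r.
exists k; first by apply: (closed_cvg _ cK _ _ kl); apply: nearW => n; case: (Hf n).
exists (x - k); last by rewrite addrC subrK.
have ml : (fun n => (f n).2) @ G --> x - k.
  have -> : (fun n => (f n).2) = (fun n => (f n).1 + (f n).2 - (f n).1).
    by apply/funext => n; rewrite addrC addKr.
  exact: cvgB.
by apply: (closed_cvg _ cM _ _ ml); apply: nearW => n; case: (Hf n).
Unshelve. all: by end_near. Qed.

(** Points far out on a ray of the sum are split as [k + m] and divided by their index; the bound
    above makes the first parts converge, to a direction of [K], and the second parts then tend to a
    direction of [M]. *)
Lemma reccone_minksum K M g : closed K -> Defs.convex_set K -> closed M -> Defs.convex_set M ->
  no_common_line K M -> reccone (minksum K M) g ->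
  exists k, reccone K k /\ reccone M (g - k).
Proof.
move=> cK vK cM vM KM [->|[[x KMx] recg]].
  by exists 0; rewrite subr0; split; left.
have : forall n : nat, exists km : V * V,
    [/\ K km.1, M km.2 & km.1 + km.2 = x + n.+1%:R *: g].
  move=> n; have [k Kk [m Mm <-]] := recg x n.+1%:R KMx (ler0n _ _).
  by exists (k, m).
move=> /choice[f Hf].
have [G [UG ooG]] := ultrafilter_nat.
pose s n : R := n.+1%:R^-1.
have sl : s @ G --> (0 : R).
  by apply: (@cvg_trans _ (s @ \oo)); [move=> A /ooG|exact: cvg_harmonic].
have s01 n : 0 <= s n <= 1 by rewrite invr_ge0 ler0n/= invf_le1// ler1n.
have s0 n : 0 <= s n by case/andP: (s01 n).
have fg : (fun n => s n *: ((f n).1 + (f n).2)) @ G --> g.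
  under eq_fun => n.
    have [_ _ ->] := Hf n.
    rewrite scalerDr scalerA mulVf ?pnatr_eq0// scale1r; over.
  apply: (@cvg_to_eq _ _ (0 *: x + g)); first by rewrite scale0r add0r.
  apply: cvgD; last exact: cvg_cst.
  exact: cvgZr_tmp.
have Kf n : K (f n).1 by case: (Hf n).
have Mf n : M (f n).2 by case: (Hf n).
have [C kC] := scaled_sum_bounded UG cK vK cM vM KM Kf Mf s01 fg.
have [k kl] := ultra_bounded_cvg UG kC.
exists k; split; first exact: (reccone_lim _ cK vK Kf s0 sl kl).
apply: (reccone_lim _ cM vM Mf s0 sl).
have -> : (fun n => s n *: (f n).2) =
    (fun n => s n *: ((f n).1 + (f n).2) - s n *: (f n).1).
  by apply/funext => n; rewrite scalerDr [X in X - _]addrC addrK.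
exact: cvgB.
Qed.

Lemma minksum_convex K M : Defs.convex_set K -> Defs.convex_set M -> Defs.convex_set (minksum K M).
Proof.
move=> vK vM _ _ l [k Kk [m Mm <-]] [k' Kk' [m' Mm' <-]] l0 l1.
exists (l *: k + (1 - l) *: k'); first exact: vK.
exists (l *: m + (1 - l) *: m'); first exact: vM.
by rewrite !scalerDr addrACA.
Qed.

End RecessionCone.

(** * Random sets with measurable hitting events *)

Section RationalBalls.
Context {R : realType} {d : nat}.
Notation V := 'rV[R]_d.

Definition ratvec (q : 'rV[rat]_d) : V := map_mx ratr q.

Definition ratball (j : 'rV[rat]_d * nat) : set V := ball (ratvec j.1) j.2.+1%:R^-1.

Lemma ratball_open j : open (ratball j).
Proof. exact: ball_open. Qed.

Lemma ratvec_dense (x : V) (e : R) : 0 < e -> exists q, ball (ratvec q) e x.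
Proof.
move=> e0.
have : forall i : 'I_d, exists q : rat, x ord0 i - e < ratr q < x ord0 i + e.
  move=> i; have [|q] := @rat_in_itvoo R (x ord0 i - e) (x ord0 i + e).
    by rewrite ltrBlDr -addrA ltrDl addr_gt0.
  by rewrite in_itv/=; exists q.
move=> /choice[q Hq]; exists (\row_i q i); split => // i j.
rewrite ord1 !mxE -ball_normE/= ltr_distl.
exact: Hq.
Qed.

(** The closed ball is required to lie in [U], so that limits of points of the ball stay in [U]. *)
Lemma ratball_base (U : set V) x : open U -> U x ->
  exists j, ratball j x /\ forall y, `|ratvec j.1 - y| <= j.2.+1%:R^-1 -> U y.
Proof.
move=> oU Ux; have /nbhs_ballP[e /= e0 eU] := open_nbhs_nbhs (conj oU Ux).
have e20 : 0 < e / 2 by rewrite divr_gt0.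
have [n _ /(_ n (leqnn n)) /= ne] := near_infty_natSinv_lt (PosNum e20).
have n0 : 0 < n.+1%:R^-1 :> R by rewrite invr_gt0.
have [q qx] := ratvec_dense x n0.
exists (q, n); split => // y /= qy; apply: eU.
rewrite -ball_normE/= (_ : x - y = (x - ratvec q) + (ratvec q - y)); last first.
  by rewrite addrA subrK.
rewrite (le_lt_trans (ler_normD _ _))// (splitr e) ltrD//.
  by move: qx; rewrite -ball_normE/= distrC => /lt_trans; exact.
exact: le_lt_trans ne.
Qed.

(** An ultrafilter limit of near-optimal points lies in the closure of every [Z n]. The vanishing
    slack lets the hypothesis be checked on open balls although the distance [r] itself is reached
    only in the limit. *)
Lemma decreasing_cluster (Z : nat -> set V) c (r : R) :
  (forall n, Z n.+1 `<=` Z n) ->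
  (forall n, exists2 z, Z n z & `|c - z| <= r + n.+1%:R^-1) ->
  exists2 l, (forall n, closure (Z n) l) & `|c - l| <= r.
Proof.
move=> decZ Hz.
have {}decZ m n : (m <= n)%N -> Z n `<=` Z m.
  elim: n => [|n IH]; first by rewrite leqn0 => /eqP ->.
  rewrite leq_eqVlt => /predU1P[->//|]; rewrite ltnS => /IH mn.
  exact: subset_trans (decZ n) mn.
have /choice[z Hz'] : forall n, exists z, Z n z /\ `|c - z| <= r + n.+1%:R^-1.
  by move=> n; have [z] := Hz n; exists z.
have [G [UG ooG]] := ultrafilter_nat.
have [l zl] : exists l : V, z @ G --> l.
  apply: (@ultra_bounded_cvg _ _ G z (`|c| + (r + 1))) => //.
  apply: nearW => n; have [_ cz] := Hz' n.
  rewrite -[z n](subKr c) (le_trans (ler_normB _ _))// lerD2l.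
  by rewrite (le_trans cz)// lerD2l invf_le1// ler1n.
exists l.
  move=> n; apply: (closed_cvg _ (@closed_closure _ (Z n)) _ _ zl).
  apply: ooG; exists n => // m /= nm; apply: subset_closure.
  by apply: (decZ _ _ nm); case: (Hz' m).
apply/ler_addgt0Pr => e e0.
apply: (@closed_cvg _ _ G _ (fun n => `|c - z n|) [set y | y <= r + e]).
- exact: closed_le.
- apply: ooG; have [n _ Hn] := near_infty_natSinv_lt (PosNum e0).
  exists n => // m /= nm; have [_ /le_trans] := Hz' m; apply.
  by rewrite lerD2l ltW//; exact: Hn.
- by apply: cvg_norm; apply: cvgB => //; exact: cvg_cst.
Qed.

End RationalBalls.

(** * Operations preserving measurability of hitting events *)

Section HitMeasurable.
Context {Omega : Type} {R : realType} {d : nat}.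
Notation V := 'rV[R]_d.
Variable (G : set (set Omega)).
Hypothesis sG : sigma_algebra setT G.
Implicit Types (X Y Z : Omega -> set V) (A B : set Omega).

Lemma salg0 : G set0. Proof. by case: sG. Qed.
Lemma salgC A : G A -> G (~` A). Proof. by case: sG => _ + _ => /[apply]; rewrite setTD. Qed.
Lemma salg_bigcup (I : countType) (D : set I) (A : I -> set Omega) :
  (forall i, D i -> G (A i)) -> G (\bigcup_(i in D) A i).
Proof.
move=> GA; case: sG => G0 _ cupG.
pose A' n := if unpickle n is Some i then
  (if `[< D i >] then A i else set0) else set0.
have -> : \bigcup_(i in D) A i = \bigcup_n A' n.
  apply/seteqP; split=> w.
    by case=> i Di Aw; exists (pickle i) => //; rewrite /A' pickleK asboolT.
  case=> n _; rewrite /A'; case: unpickle => // i.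
  by case: asboolP => // Di Aw; exists i.
apply: cupG => n; rewrite /A'; case: unpickle => // i.
by case: asboolP => // Di; exact: GA.
Qed.
Lemma salg_bigcap (I : countType) (D : set I) (A : I -> set Omega) :
  (forall i, D i -> G (A i)) -> G (\bigcap_(i in D) A i).
Proof.
move=> GA; rewrite -[X in G X]setCK setC_bigcap; apply/salgC/salg_bigcup => i Di.
exact/salgC/GA.
Qed.
Lemma salgU A B : G A -> G B -> G (A `|` B).
Proof.
move=> GA GB; rewrite (_ : _ `|` _ = \bigcup_(b in [set: bool]) if b then A else B).
  by apply: salg_bigcup => -[].
apply/seteqP; split=> w; first by case=> ?; [exists true|exists false].
by case=> -[] _; [left|right].
Qed.
Lemma salgI A B : G A -> G B -> G (A `&` B).
Proof. by move=> /salgC GA /salgC GB; rewrite -[X in G X]setCK setCI; exact/salgC/salgU. Qed.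

(** Effros measurability, without closedness, so that sums, traces on open sets and unions can be
    treated before any closure is taken. *)
Definition hit_measurable X := forall U : set V, open U -> G [set w | X w `&` U !=set0].

Lemma hit_measurable_eq X Y : (forall w, X w = Y w) -> hit_measurable X -> hit_measurable Y.
Proof. by move=> /funext ->. Qed.

Lemma hit_measurable_nonempty X : hit_measurable X -> G [set w | X w !=set0].
Proof.
move=> /(_ setT openT); congr G; apply/seteqP; split => w /=.
  by case=> x []; exists x.
by case=> x; exists x.
Qed.

(** An open set of the product is a countable union of products of rational balls, and each product
    is hit exactly when both factors are. *)
Lemma hit_measurable2 X Y (O : set (V * V)) :
  hit_measurable X -> hit_measurable Y -> open O ->
  G [set w | exists x y, [/\ X w x, Y w y & O (x, y)]].
Proof.
move=> mX mY oO.
rewrite (_ : mkset _ = \bigcup_(ij in [set ij | ratball ij.1 `*` ratball ij.2 `<=` O])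
    ([set w | X w `&` ratball ij.1 !=set0] `&` [set w | Y w `&` ratball ij.2 !=set0])).
  by apply: salg_bigcup => -[i j] _; apply: salgI; [apply: mX|apply: mY]; exact: ratball_open.
apply/seteqP; split => w.
  move=> [x [y [Xx Yy Oxy]]].
  have [[A B] /= [nA nB] ABO] : nbhs (x, y) O by exact: open_nbhs_nbhs.
  have [i [ix iA]] := ratball_base (open_interior A) nA.
  have [j [jy jB]] := ratball_base (open_interior B) nB.
  exists (i, j); last by split; [exists x|exists y].
  move=> [x' y'] /= [ix' jy']; apply: ABO; split => /=; apply: interior_subset.
    by apply: iA; apply: ltW; move: ix'; rewrite /ratball -ball_normE.
  by apply: jB; apply: ltW; move: jy'; rewrite /ratball -ball_normE.
by case=> -[i j] /= ijO [[x [Xx ix]] [y [Yy jy]]]; exists x, y; split=> //; exact: ijO.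
Qed.

Lemma hit_measurable_image2 X Y (f : V * V -> V) :
  continuous f -> hit_measurable X -> hit_measurable Y ->
  hit_measurable (fun w => [set f xy | xy in X w `*` Y w]).
Proof.
move=> cf mX mY U oU.
have oO : open (f @^-1` U) by apply: open_comp => // x _; exact: cf.
move: (hit_measurable2 mX mY oO); congr G; apply/seteqP; split => w /=.
  by move=> [x [y [Xx Yy Uf]]]; exists (f (x, y)); split=> //; exists (x, y).
by move=> [_ [[[x y] [/= Xx Yy] <-] Uf]]; exists x, y.
Qed.

Lemma hit_measurable_closure X : hit_measurable X -> hit_measurable (fun w => closure (X w)).
Proof.
move=> mX U oU; move: (mX U oU); congr G; apply/seteqP; split => w /= [x [Xx Ux]].
  by exists x; split=> //; exact: subset_closure.
by apply: (Xx U); exact: open_nbhs_nbhs.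
Qed.

Lemma hit_measurable_bigcup (I : countType) (X : I -> Omega -> set V) :
  (forall i, hit_measurable (X i)) -> hit_measurable (fun w => \bigcup_i X i w).
Proof.
move=> mX U oU.
rewrite (_ : mkset _ = \bigcup_i [set w | X i w `&` U !=set0]).
  by apply: salg_bigcup => i _; exact: mX.
apply/seteqP; split => w; first by case=> x [[i _ Xx] Ux]; exists i => //; exists x.
by case=> i _ [x [Xx Ux]]; exists x; split=> //; exists i.
Qed.

Lemma hit_measurable_cst (S : set V) : hit_measurable (fun=> S).
Proof.
move=> U oU; have [SU|SU] := pselect (S `&` U !=set0).
  rewrite (_ : mkset _ = ~` set0); first exact/salgC/salg0.
  by rewrite setC0; apply/seteqP; split.
rewrite (_ : mkset _ = set0); first exact: salg0.
by apply/seteqP; split.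
Qed.

Lemma hit_measurable_if A X Y : G A -> hit_measurable X -> hit_measurable Y ->
  hit_measurable (fun w => if w \in A then X w else Y w).
Proof.
move=> GA mX mY U oU.
rewrite (_ : mkset _ = (A `&` [set w | X w `&` U !=set0]) `|`
  (~` A `&` [set w | Y w `&` U !=set0])).
  by apply: salgU; apply: salgI; [|exact: mX|exact: salgC|exact: mY].
apply/seteqP; split => w /=.
  by case: ifPn; [rewrite inE; left|rewrite notin_setE; right].
by case=> -[Aw h]; [rewrite mem_set|rewrite memNset].
Qed.

Lemma hit_measurable_setIopen X (O : set V) : open O -> hit_measurable X ->
  hit_measurable (fun w => X w `&` O).
Proof.
move=> oO mX U oU; under eq_set do rewrite -setIA.
by apply: mX; exact: openI.
Qed.

(** By compactness, the intersection meets a closed rational ball as soon as every [Z n] meets the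
    open ball enlarged by [n.+1%:R^-1]; this leaves countably many events. *)
Lemma hit_measurable_decreasing (Z : nat -> Omega -> set V) :
  (forall n, hit_measurable (Z n)) -> (forall n w, Z n.+1 w `<=` Z n w) ->
  hit_measurable (fun w => \bigcap_n closure (Z n w)).
Proof.
move=> mZ decZ U oU.
pose C (j : 'rV[rat]_d * nat) := [set y : V | `|ratvec j.1 - y| <= j.2.+1%:R^-1].
pose B (j : 'rV[rat]_d * nat) (n : nat) : set V :=
  ball (ratvec j.1) (j.2.+1%:R^-1 + n.+1%:R^-1).
rewrite (_ : mkset _ = \bigcup_(j in [set j | C j `<=` U])
    \bigcap_n [set w | Z n w `&` B j n !=set0]).
  apply: salg_bigcup => j _; apply: salg_bigcap => n _; apply: mZ.
  exact: ball_open.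
apply/seteqP; split => w.
  case=> x [Zx Ux]; have [j [jx jU]] := ratball_base oU Ux.
  exists j => // n _; apply: Zx => //; apply: open_nbhs_nbhs; split.
    exact: ball_open.
  by apply: le_ball jx; rewrite lerDl.
case=> j /= jU jZ.
have [|l cl lC] := @decreasing_cluster _ _ (Z ^~ w) (ratvec j.1) j.2.+1%:R^-1 (decZ^~ w).
  move=> n; have [z [Zz zB]] := jZ n I; exists z => //; apply: ltW.
  by move: zB; rewrite /B -ball_normE.
by exists l; split; [move=> n _; exact: cl|exact: jU].
Qed.

(** The intersection is the decreasing limit of the points of [X] at distance less than [n.+1%:R^-1]
    from [Y], a condition that is open in the pair of points. *)
Lemma hit_measurable_setI X Y : (forall w, closed (X w)) -> (forall w, closed (Y w)) ->
  hit_measurable X -> hit_measurable Y -> hit_measurable (fun w => X w `&` Y w).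
Proof.
move=> cX cY mX mY.
pose Z (n : nat) w := [set x | X w x /\ exists2 y, Y w y & `|x - y| < n.+1%:R^-1].
apply: (@hit_measurable_eq (fun w => \bigcap_n closure (Z n w))); last first.
  apply: hit_measurable_decreasing => [n U oU|n w x [Xx [y Yy xy]]]; last first.
    split=> //; exists y => //; apply: (lt_le_trans xy).
    by rewrite lef_pV2 ?posrE// ler_nat.
  pose O := [set xy : V * V | U xy.1] `&` [set xy : V * V | `|xy.1 - xy.2| < n.+1%:R^-1].
  have oO : open O.
    apply: openI; first by apply: open_comp => // x _; exact: cvg_fst.
    apply: (@open_comp _ _ (fun xy : V * V => `|xy.1 - xy.2|) [set r | r < n.+1%:R^-1]).
      by move=> x _; apply: cvg_norm; apply: cvgB; [exact: cvg_fst|exact: cvg_snd].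
    exact: open_lt.
  move: (hit_measurable2 mX mY oO); congr G; apply/seteqP; split => w /=.
    by move=> [x [y [Xx Yy [/= Ux xy]]]]; exists x; split=> //; split=> //; exists y.
  by move=> [x [[Xx [y Yy xy]] Ux]]; exists x, y.
move=> w; apply/seteqP; split => x.
  move=> Zx; split.
    by apply: (cX w); apply: closureS (Zx 0%N I) => y [].
  apply: (cY w) => B /nbhs_ballP[e /= e0 eB].
  have e20 : 0 < e / 2 by rewrite divr_gt0.
  have [n _ /(_ n (leqnn n)) /= ne] := near_infty_natSinv_lt (PosNum e20).
  have [z [[Xz [y Yy zy]] xz]] := Zx n I _ (nbhsx_ballx x (PosNum e20)%:num ltac:(by [])).
  exists y; split=> //; apply: eB; rewrite (splitr e).
  apply: (ball_triangle xz); rewrite -ball_normE/=; exact: lt_trans ne.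
move=> [Xx Yx] n _; apply: subset_closure; split=> //; exists x => //.
by rewrite subrr normr0.
Qed.

(* Kuratowski and Ryll-Nardzewski: shrink the random set repeatedly to its
   trace on the first rational ball of radius [1/(n+1)] that it hits. *)
Let first_hit (n : nat) Z w (q : 'rV[rat]_d) := Z w `&` ratball (q, n) !=set0 /\
  forall q', (pickle q' < pickle q)%N -> ~ (Z w `&` ratball (q', n) !=set0).
Let shrink (n : nat) Z w :=
  [set x | Z w x /\ exists2 q, first_hit n Z w q & ratball (q, n) x].

Let shrink_measurable n Z : hit_measurable Z -> hit_measurable (shrink n Z).
Proof.
move=> mZ U oU.
rewrite (_ : mkset _ = \bigcup_(q in [set: 'rV[rat]_d])
   ([set w | Z w `&` (ratball (q, n) `&` U) !=set0] `&`
    \bigcap_(q' in [set q' | (pickle q' < pickle q)%N])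
      ~` [set w | Z w `&` ratball (q', n) !=set0])).
  apply: salg_bigcup => q _; apply: salgI; first by apply: mZ; apply: openI => //; exact: ratball_open.
  by apply: salg_bigcap => q' _; apply: salgC; apply: mZ; exact: ratball_open.
apply/seteqP; split => w.
  by move=> [x [[Zx [q [qZ qmin] qx]] Ux]]; exists q => //; split => //; exists x.
move=> [q _ [[x [Zx [qx Ux]]] qmin]]; exists x; split=> //; split=> //.
by exists q => //; split => //; exists x.
Qed.

Let shrink_nonempty n Z w : Z w !=set0 -> shrink n Z w !=set0.
Proof.
move=> [x Zx].
have ex : exists m, `[< exists2 q : 'rV[rat]_d, pickle q = m & Z w `&` ratball (q, n) !=set0 >].
  have n0 : 0 < n.+1%:R^-1 :> R by rewrite invr_gt0.
  have [q qx] := ratvec_dense x n0.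
  by exists (pickle q); apply/asboolP; exists q => //; exists x.
case: (ex_minnP ex) => m /asboolP[q qm [y [Zy qy]]] mmin.
exists y; split=> //; exists q => //; split; first by exists y.
move=> q'; rewrite qm => q'm q'Z; move: q'm; apply/negP; rewrite -leqNgt.
by apply: mmin; apply/asboolP; exists q'.
Qed.

Let shrink_small n Z w : exists q, shrink n Z w `<=` ratball (q, n).
Proof.
have [[q qf]|nq] := pselect (exists q, first_hit n Z w q); last first.
  by exists 0 => x [_ [q qf]]; case: nq; exists q.
exists q => x [_ [q' [q'Z q'min] q'x]].
have [qq'|qq'|qq'] := ltngtP (pickle q') (pickle q).
- by case: (qf.2 _ qq').
- by case: (q'min _ qq'); exact: qf.1.
- by move: q'x; rewrite (pcan_inj (@pickleK _) qq').
Qed.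

(** The successive traces have closures meeting in one point, whose singleton is measurable as a
    decreasing limit. The limit may leave a set that is not closed, hence the closure in the
    conclusion. *)
Lemma measurable_selection Z : hit_measurable Z ->
  exists f : Omega -> V, hit_measurable (fun w => [set f w]) /\
    forall w, Z w !=set0 -> closure (Z w) (f w).
Proof.
move=> mZ.
pose Z0 w := if w \in [set w | Z w !=set0] then Z w else [set 0].
pose fix Zs n := if n is n'.+1 then shrink n' (Zs n') else Z0.
have mZs n : hit_measurable (Zs n).
  elim: n => [|n IH]; last exact: shrink_measurable.
  apply: hit_measurable_if => //; first exact: hit_measurable_nonempty.
  exact: hit_measurable_cst.
have Zs0 n w : Zs n w !=set0.
  elim: n => [|n IH]; last exact: shrink_nonempty.
  by rewrite /= /Z0; case: ifPn; [rewrite inE|exists 0].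
have Zsdec n w : Zs n.+1 w `<=` Zs n w by move=> x [].
have ex w : exists x, (\bigcap_n closure (Zs n w)) x.
  have [q qZ] := @shrink_small 0 Z0 w.
  have decZ' n : Zs n.+2 w `<=` Zs n.+1 w by exact: Zsdec.
  have Z'1 n : Zs n.+1 w `<=` Zs 1%N w.
    by elim: n => // n IH; exact: subset_trans (decZ' n) IH.
  (* The sequence is shifted by one because [Z0 w] may be unbounded; from [Zs 1] on, everything lies
     in one ball of radius 1. *)
  have [|l cl _] := @decreasing_cluster _ _ (fun n => Zs n.+1 w) (ratvec q) 1 decZ'.
    move=> n; have [z zZ] := Zs0 n.+1 w; exists z => //.
    have : ratball (q, 0%N) z by apply: qZ; exact: Z'1 zZ.
    rewrite /ratball -ball_normE/= invr1 => /ltW /le_trans; apply.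
    by rewrite lerDl.
  by exists l => n _; apply: (closureS (@Zsdec n w)).
have uniq w x y : (\bigcap_n closure (Zs n w)) x -> (\bigcap_n closure (Zs n w)) y -> x = y.
  move=> Zx Zy; apply/eqP; rewrite -subr_eq0 -normr_eq0 eq_le normr_ge0 andbT.
  apply/ler_addgt0Pr => e e0; rewrite add0r.
  have e20 : 0 < e / 2 by rewrite divr_gt0.
  have [n _ /(_ n (leqnn n)) /= ne] := near_infty_natSinv_lt (PosNum e20).
  have [q qZ] := @shrink_small n (Zs n) w.
  have cl z : (\bigcap_n closure (Zs n w)) z -> `|ratvec q - z| <= n.+1%:R^-1.
    have cC : closed [set z : V | `|ratvec q - z| <= n.+1%:R^-1].
      exact: closed_closed_ball_.
    move=> Zz; apply: cC; apply: closureS (Zz n.+1 I) => z' /qZ.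
    by rewrite /ratball -ball_normE => /ltW.
  rewrite (_ : x - y = (ratvec q - y) - (ratvec q - x)); last first.
    by rewrite opprB [RHS]addrC addrA subrK.
  rewrite (le_trans (ler_normB _ _))// (splitr e) lerD//.
    by rewrite (le_trans (cl _ Zy))// ltW.
  by rewrite (le_trans (cl _ Zx))// ltW.
have /choice[f Hf] := ex.
exists f; split.
  apply: (@hit_measurable_eq (fun w => \bigcap_n closure (Zs n w))).
    move=> w; apply/seteqP; split => [x Zx /=|_ ->]; last exact: Hf.
    exact: uniq Zx (Hf w).
  exact: hit_measurable_decreasing.
by move=> w Zw; have := Hf w 0%N I; rewrite /= /Z0 mem_set.
Qed.

Lemma hit_measurable_setU X Y : hit_measurable X -> hit_measurable Y ->
  hit_measurable (fun w => X w `|` Y w).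
Proof.
move=> mX mY; apply: (@hit_measurable_eq (fun w => \bigcup_(b : bool) (if b then X w else Y w))).
  move=> w; apply/seteqP; split=> x; first by case=> -[] _; [left|right].
  by case=> ?; [exists true|exists false].
by apply: (@hit_measurable_bigcup _ (fun b w => if b then X w else Y w)) => -[].
Qed.

(** Based at a selection [f], the recession cone is the intersection of the rescaled sets
    [n.+1%:R^-1 *: (X w - f w)], which decrease by convexity. Adjoining 0 gives the value wanted
    where [X w] is empty. *)
Lemma hit_measurable_reccone X : (forall w, closed (X w)) ->
  (forall w, Defs.convex_set (X w)) -> hit_measurable X ->
  hit_measurable (fun w => reccone (X w)).
Proof.
move=> cX vX mX.
have [f [mf Hf]] := measurable_selection mX.
have {}Hf w : X w !=set0 -> X w (f w) by move=> /Hf; exact: cX.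
pose Z (n : nat) w := [set 0] `|`
  [set n.+1%:R^-1 *: (xy.1 - xy.2) | xy in X w `*` [set f w]].
have ZX n w v : X w !=set0 -> Z n w v -> X w (f w + n.+1%:R *: v).
  move=> X0 [->|[[x y] [/= Xx ->] <-]]; first by rewrite scaler0 addr0; exact: Hf.
  by rewrite scalerA mulfV ?pnatr_eq0// scale1r addrC subrK.
have XZ n w v : X w (f w + n.+1%:R *: v) -> Z n w v.
  move=> Xv; right; exists (f w + n.+1%:R *: v, f w) => //=.
  by rewrite [X in X - _]addrC addrK scalerA mulVf ?pnatr_eq0// scale1r.
apply: (@hit_measurable_eq (fun w => \bigcap_n closure (Z n w))); last first.
  apply: hit_measurable_decreasing => [n|n w v].
    apply: hit_measurable_setU; first exact: hit_measurable_cst.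
    apply: hit_measurable_image2 => // xy.
    apply: cvgZ; first exact: cvg_cst.
    by apply: cvgB; [exact: cvg_fst|exact: cvg_snd].
  move=> Zv; have [X0|X0] := pselect (X w !=set0); last first.
    by case: Zv => [|[[x y] [/= Xx]]]; [left|case: X0; exists x].
  apply: XZ; move/ZX : Zv => /(_ X0) Xv.
  have n2 : n.+2%:R != 0 :> R by rewrite pnatr_eq0.
  have l0 : 0 <= n.+1%:R / n.+2%:R :> R by rewrite divr_ge0.
  have l1 : n.+1%:R / n.+2%:R <= 1 :> R by rewrite ler_pdivrMr// mul1r ler_nat.
  have := vX w _ _ _ Xv (Hf _ X0) l0 l1.
  rewrite scalerDr scalerA divfK// scalerBl scale1r addrC addrA subrK.
  by [].
move=> w; apply/seteqP; split => v.
  have [X0|X0] := pselect (X w !=set0) => Zv; last first.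
    left; suff : closure [set (0 : V)] v.
      exact: (@accessible_closed_set1 _ (hausdorff_accessible (@norm_hausdorff _ _))).
    apply: closureS (Zv 0%N I) => u [//|[[x y] [/= Xx]]].
    by case: X0; exists x.
  apply: (@reccone_ray _ _ _ (f w)) => // n.
  apply: (@closed_affine_preimage _ _ (X w) (f w) n.+1%:R (cX w)).
  by apply: closureS (Zv n I) => u /ZX; exact.
move=> [->|[X0 Xv]] n _; apply: subset_closure; first by left.
by apply: XZ; apply: Xv => //; exact: Hf.
Qed.

End HitMeasurable.

(** * Measurability of random vectors and the conditional core *)

Section RandomSets.
Context {dsp : measure_display} {Omega : measurableType dsp} {R : realType} {d : nat}.
Notation V := 'rV[R]_d.
Variables (P : probability Omega R) (G : set (set Omega)).
Hypothesis sG : sigma_algebra setT G.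
Implicit Types (X Y Z M : Omega -> set V) (f g : Omega -> V).

(** In the supremum norm a ball is a product of coordinate balls, which gives one direction; the
    other holds because open intervals generate the Borel sets of the line. *)
Lemma Gmeas_hit_measurable f : Gmeas G f <-> hit_measurable G (fun w => [set f w]).
Proof.
split=> [mf U oU|mf i B mB].
  rewrite (_ : mkset _ = \bigcup_(j in [set j | ratball j `<=` U])
      \bigcap_(i in [set: 'I_d])
        ((fun w => f w ord0 i) @^-1` ball (ratvec j.1 ord0 i) (j.2.+1%:R^-1 : R))).
    apply: salg_bigcup => // j _; apply: salg_bigcap => // i _; apply: mf.
    by apply: open_measurable; exact: ball_open.
  apply/seteqP; split => w.
    case=> _ [-> Ux]; have [j [jx jU]] := ratball_base oU Ux.
    exists j; last by move=> i _; case: jx => _; exact.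
    by move=> y jy; apply: jU; apply: ltW; move: jy; rewrite /ratball -ball_normE.
  case=> j /= jU jf; exists (f w); split=> //; apply: jU; split=> // k i.
  by rewrite ord1; exact: jf.
have mB' : <<s @RGenOpens.G R >> B by rewrite -[<<s _ >>]RGenOpens.measurableE.
suff /(_ _ mB') : <<s @RGenOpens.G R >> `<=` image_set_system setT (fun w => f w ord0 i) G.
  by rewrite /image_set_system /= setTI.
apply: smallest_sub; first exact: sigma_algebra_image.
move=> _ [a [b ->]]; rewrite /image_set_system /= setTI.
have oO : open [set x : V | `]a, b[%classic (x ord0 i)].
  apply: (@open_comp _ _ (fun x : V => x ord0 i) `]a, b[%classic).
    by move=> x _; exact: coord_continuous.
  exact: interval_open.
move: (mf _ oO); congr G; apply/seteqP; split => w /=; first by case=> x [/= -> ].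
by move=> h; exists (f w).
Qed.

Lemma Gmeas_comp2 (h : V * V -> V) f g : continuous h -> Gmeas G f -> Gmeas G g ->
  Gmeas G (fun w => h (f w, g w)).
Proof.
move=> ch /Gmeas_hit_measurable mf /Gmeas_hit_measurable mg.
apply/Gmeas_hit_measurable; apply: hit_measurable_eq (hit_measurable_image2 sG ch mf mg) => w.
apply/seteqP; split => x /=; first by case=> -[y z] [/= -> ->].
by move=> ->; exists (f w, g w).
Qed.

Lemma GmeasD f g : Gmeas G f -> Gmeas G g -> Gmeas G (fun w => f w + g w).
Proof.
move=> mf mg; apply: (@Gmeas_comp2 (fun xy => xy.1 + xy.2) _ _ _ mf mg) => xy.
by apply: cvgD; [exact: cvg_fst|exact: cvg_snd].
Qed.

Lemma GmeasN f : Gmeas G f -> Gmeas G (fun w => - f w).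
Proof.
move=> mf; apply: (@Gmeas_comp2 (fun xy => - xy.1) _ _ _ mf mf) => xy.
by apply: cvgN; exact: cvg_fst.
Qed.

Lemma GmeasB f g : Gmeas G f -> Gmeas G g -> Gmeas G (fun w => f w - g w).
Proof. by move=> mf /GmeasN; exact: GmeasD. Qed.

Lemma Gmeas_cst (x : V) : Gmeas G (fun=> x).
Proof. by apply/Gmeas_hit_measurable; exact: hit_measurable_cst. Qed.

Lemma Gmeas_sum (I : Type) (r : seq I) (D : pred I) (F : I -> Omega -> V) :
  (forall i, D i -> Gmeas G (F i)) -> Gmeas G (fun w => \sum_(i <- r | D i) F i w).
Proof.
move=> mF; elim: r => [|i r IH].
  by under eq_fun do rewrite big_nil; exact: Gmeas_cst.
case Di: (D i); under eq_fun do rewrite big_cons Di; last exact: IH.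
exact: GmeasD (mF _ Di) IH.
Qed.

Lemma Gmeas_if A f g : G A -> Gmeas G f -> Gmeas G g ->
  Gmeas G (fun w => if w \in A then f w else g w).
Proof.
move=> GA /Gmeas_hit_measurable mf /Gmeas_hit_measurable mg.
apply/Gmeas_hit_measurable; apply: hit_measurable_eq (hit_measurable_if sG GA mf mg) => w.
by case: ifP.
Qed.

Lemma hit_measurable_shift f X : Gmeas G f -> hit_measurable G X ->
  hit_measurable G (fun w => [set y | X w (f w - y)]).
Proof.
move=> /Gmeas_hit_measurable mf mX.
apply: (@hit_measurable_eq _ _ _ _
    (fun w => [set xy.1 - xy.2 | xy in [set f w] `*` X w])).
  move=> w; apply/seteqP; split => y; first by case=> -[_ x] [/= -> Xx] <-; rewrite subKr.
  by move=> /= Xy; exists (f w, f w - y) => //=; rewrite subKr.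
apply: hit_measurable_image2 => // xy.
by apply: cvgB; [exact: cvg_fst|exact: cvg_snd].
Qed.

Lemma L0_nonempty Z : rand_closed_set G Z -> {ae P, forall w, Z w !=set0} ->
  exists f, L0 P G Z f.
Proof.
move=> [cZ mZ] Z0; have [f [mf Hf]] := measurable_selection sG mZ.
exists f; split; first exact/Gmeas_hit_measurable.
by apply: filterS Z0 => w /Hf; exact: cZ.
Qed.

Lemma ae_forall_countable (I : countType) (Q : I -> Omega -> Prop) :
  (forall i, {ae P, forall w, Q i w}) -> {ae P, forall w, forall i, Q i w}.
Proof.
move=> aeQ.
have /ae_foralln : forall n, {ae P, forall w, if unpickle n is Some i then Q i w else True}.
  by move=> n; case: (unpickle n) => [i|]; [exact: aeQ|exact: aeW].
by apply: filterS => w h i; have := h (pickle i); rewrite pickleK.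
Qed.

(** * Existence of the conditional core by exhaustion *)

Section ConditionalCore.
Hypothesis Gsub : forall A, G A -> measurable A.

(* Among the measurable random subsets of [X], a class closed under countable
   unions, pick one whose probability of hitting each rational ball is maximal. *)
Lemma ccore_exists X : (forall w, closed (X w)) -> exists M, is_ccore P G X M.
Proof.
move=> cX.
pose C Z := hit_measurable G Z /\ as_subset P Z X.
pose hit Z j := [set w | Z w `&` ratball j !=set0].
pose p Z j : R := fine (P (hit Z j)).
have mhit Z j : C Z -> measurable (hit Z j).
  by move=> [mZ _]; apply: Gsub; apply: mZ; exact: ratball_open.
have pE Z j : C Z -> P (hit Z j) = (p Z j)%:E.
  move=> /(mhit _ j) mZ; rewrite fineK// fin_num_measure//.
pose S j := [set p Z j | Z in C].
have supS j : has_sup (S j).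
  split.
    exists (p (fun=> set0) j); exists (fun=> set0) => //.
    by split; [exact: hit_measurable_cst|apply: aeW => w x].
  exists 1 => _ [Z CZ <-]; rewrite -lee_fin -pE//; apply: probability_le1.
  exact: mhit.
have /choice[Z HZ] : forall jn : ('rV[rat]_d * nat) * nat, exists Z, C Z /\
    sup (S jn.1) - jn.2.+1%:R^-1 < p Z jn.1.
  move=> [j n]; have n0 : 0 < n.+1%:R^-1 :> R by rewrite invr_gt0.
  by have [_ [Z CZ <-] h] := sup_adherent n0 (supS j); exists Z.
(* One countable union, over all balls and all precisions, reaches every supremum at once. *)
pose M w := closure (\bigcup_jn Z jn w).
have CM : C M.
  split; first by apply: hit_measurable_closure; apply: hit_measurable_bigcup => // jn;
    case: (HZ jn) => -[].
  have /ae_forall_countable : forall jn, as_subset P (Z jn) X by move=> jn; case: (HZ jn) => -[].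
  apply: filterS => w ZX x Mx; apply: cX; apply: closureS Mx => y [jn _ Zy].
  exact: ZX Zy.
have pM j : sup (S j) <= p M j.
  apply/ler_addgt0Pr => e e0.
  have [n _ /(_ n (leqnn n)) /= ne] := near_infty_natSinv_lt (PosNum e0).
  have [CZ h] := HZ (j, n).
  rewrite -lerBlDr; apply: (le_trans _ (_ : p (Z (j, n)) j <= _)).
    by apply: (le_trans _ (ltW h)); rewrite lerD2l lerN2 ltW.
  rewrite -lee_fin -!pE//; apply: le_measure; rewrite ?inE; [exact: mhit|exact: mhit|].
  move=> w [x [Zx jx]]; exists x; split=> //; apply: subset_closure.
  by exists (j, n).
exists M; split; first by split=> [w|]; [exact: closed_closure|exact: CM.1].
split; first exact: CM.2.
move=> Y [_ mY] YX.
pose W w := Y w `|` M w.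
have CW : C W.
  split; first by apply: hit_measurable_setU => //; exact: CM.1.
  by apply: filterS2 YX CM.2 => w YX MX x [/YX|/MX].
have hitMW j : hit M j `<=` hit W j by move=> w [x [Mx jx]]; exists x; split=> //; right.
(* Adding [Y] cannot raise a hitting probability above the supremum that [M] already attains. *)
have null j : P (hit W j `\` hit M j) = 0%E.
  rewrite measureD; [|exact: mhit|exact: mhit|].
    rewrite setIidr//.
    have e : (P (hit W j) - P (hit M j) = (p W j - p M j)%:E)%E by rewrite !pE.
    apply: (etrans e); congr EFin; apply/eqP; rewrite eq_le.
    rewrite subr_le0 subr_ge0 (le_trans _ (pM j))/=; last first.
      by apply: ub_le_sup; [case: (supS j)|exists W].
    rewrite -lee_fin -!pE//; apply: le_measure; rewrite ?inE//; exact: mhit.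
  have h : (P (hit W j) < +oo)%E by rewrite pE// ltry.
  exact: h.
have /ae_forall_countable : forall j, {ae P, forall w, hit W j w -> hit M j w}.
  move=> j; exists (hit W j `\` hit M j); split=> //.
    by apply: measurableD; exact: mhit.
  by move=> w /= /not_implyP.
apply: filterS => w hW x Yx; apply: (@closed_closure _ (\bigcup_jn Z jn w)) => B /= xB.
have [j [jx jB]] := ratball_base (open_interior B) xB.
have [|y [My jy]] := hW j; first by exists x; split=> //; left.
exists y; split=> //; apply: interior_subset; apply: jB; apply: ltW.
by move: jy; rewrite /ratball -ball_normE.
Qed.

End ConditionalCore.

(** The closed set of two-point combinations of [M] is again a measurable random subset of [X], so
    maximality absorbs it into [M]. *)
Lemma ccore_convex X M : (forall w, closed (X w)) -> (forall w, Defs.convex_set (X w)) ->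
  is_ccore P G X M -> {ae P, forall w, Defs.convex_set (M w)}.
Proof.
move=> cX vX [[cM mM] [MX maxM]].
pose Y w := closure [set z | exists x y (l : R),
  [/\ M w x, M w y, 0 <= l, l <= 1 & z = l *: x + (1 - l) *: y]].
have : as_subset P Y M.
  apply: maxM; last first.
    apply: filterS MX => w MX z Yz; apply: cX; apply: closureS Yz.
    by move=> _ [x [y [l [Mx My l0 l1 ->]]]]; apply: vX => //; exact: MX.
  split=> [w|]; first exact: closed_closure.
  apply: hit_measurable_closure => U oU.
  (* The uncountable union over weights is taken inside the product space, where openness alone
     suffices. *)
  pose O := \bigcup_(l in [set l : R | 0 <= l <= 1])
    [set xy : V * V | U (l *: xy.1 + (1 - l) *: xy.2)].
  have oO : open O.
    apply: bigcup_open => l _; apply: open_comp => // xy _.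
    apply: cvgD; (apply: cvgZ; [exact: cvg_cst|]); [exact: cvg_fst|exact: cvg_snd].
  move: (hit_measurable2 sG mM mM oO); congr G; apply/seteqP; split => w /=.
    move=> [x [y [Mx My [l /= /andP[l0 l1] Ul]]]]; exists (l *: x + (1 - l) *: y).
    by split=> //; exists x, y, l.
  move=> [_ [[x [y [l [Mx My l0 l1 ->]]]] Ul]]; exists x, y; split=> //.
  by exists l => //=; rewrite l0.
apply: filterS => w YM x y l Mx My l0 l1; apply: YM; apply: subset_closure.
by exists x, y, l.
Qed.

(** The singleton of a measurable selection is a random closed subset of [X], to which maximality
    applies. *)
Lemma ccore_selection X M f : is_ccore P G X M -> Gmeas G f ->
  {ae P, forall w, X w (f w)} -> {ae P, forall w, M w (f w)}.
Proof.
move=> [_ [_ maxM]] /Gmeas_hit_measurable mf Xf.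
have : as_subset P (fun w => [set f w]) M.
  apply: maxM; last by apply: filterS Xf => w Xf _ ->.
  split=> // w; exact: (@accessible_closed_set1 _ (hausdorff_accessible (@norm_hausdorff _ _))).
by apply: filterS => w; exact.
Qed.

Hypothesis Gnull : forall N : set Omega, P.-negligible N -> G N.

Lemma hit_measurable_ae X Y : {ae P, forall w, X w = Y w} ->
  hit_measurable G X -> hit_measurable G Y.
Proof.
move=> XY mX U oU.
rewrite (_ : mkset _ = ([set w | X w `&` U !=set0] `&` [set w | X w = Y w]) `|`
   ([set w | Y w `&` U !=set0] `&` ~` [set w | X w = Y w])).
  apply: salgU => //; last by apply: Gnull; apply: negligibleS XY => w [].
  apply: salgI => //; first exact: mX.
  by rewrite -[X in G X]setCK; apply: salgC => //; exact: Gnull.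
apply/seteqP; split => w /=; last by case=> -[] // + XYw; rewrite XYw.
move=> h; have [XYw|XYw] := pselect (X w = Y w); last by right.
by left; rewrite XYw.
Qed.

Lemma convex_ccore_exists X : (forall A, G A -> measurable A) ->
  (forall w, closed (X w)) -> (forall w, Defs.convex_set (X w)) ->
  exists M, is_ccore P G X M /\ forall w, Defs.convex_set (M w).
Proof.
move=> Gsub cX vX; have [M cM] := ccore_exists Gsub cX.
have vM := ccore_convex cX vX cM.
pose M' w := if `[< Defs.convex_set (M w) >] then M w else set0.
have MM' : {ae P, forall w, M w = M' w}.
  by apply: filterS vM => w vM; rewrite /M' asboolT.
case: cM => -[clM mM] [MX maxM]; exists M'; split.
  split; last split.
  - split=> [w|]; last exact: hit_measurable_ae MM' mM.
    by rewrite /M'; case: asboolP => // _; exact: closed0.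
  - by apply: filterS2 MM' MX => w <-.
  - by move=> Y mY YX; apply: filterS2 MM' (maxM Y mY YX) => w <-.
by move=> w; rewrite /M'; case: asboolP => // _ x y l.
Qed.

End RandomSets.

(** * Superhedging *)

Section Superhedging.
Context {dsp : measure_display} {Omega : measurableType dsp} {R : realType} {d : nat}.
Notation V := 'rV[R]_d.
Variables (P : probability Omega R) (T : nat) (F : nat -> set (set Omega))
  (K : nat -> Omega -> set V) (xi : Omega -> V).
Hypothesis Fsigma : forall t, sigma_algebra setT (F t).
Hypothesis Fsub : forall t (A : set Omega), F t A -> measurable A.
Hypothesis Fnegl : forall t (N : set Omega), P.-negligible N -> F t N.
Hypothesis Fincr : forall s t, (s <= t)%N -> forall A, F s A -> F t A.
Hypothesis Kmeas : forall t, (t <= T)%N -> rand_closed_convex_set (F t) (K t).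
Hypothesis K0 : forall t, (t <= T)%N -> {ae P, forall w, K t w 0}.
Hypothesis Kstrict : forall t, (t <= T)%N ->
     {ae P, forall w, K t w `&` negset (K t w) = [set 0]}.
Hypothesis NAs : forall t, (t <= T)%N ->
     Aset P F K 0 t `&` L0 P (F t) (K t) `<=` L0 P (F t) (fun w => Kzero (K t w)).

Implicit Types (f g : Omega -> V).

Lemma Gmeas_incr s t f : (s <= t)%N -> Gmeas (F s) f -> Gmeas (F t) f.
Proof. by move=> st mf i B mB; apply: Fincr st _ _; exact: mf. Qed.

(** The last trade is minus the sum of the earlier ones, hence attainable from zero, and it lies in
    [K n]. No arbitrage puts it in the [Kzero] part, strict properness makes it vanish, and the
    remaining trades again sum to zero. *)
Lemma zero_sum_trades n t (k : nat -> Omega -> V) : (n <= T.+1)%N ->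
  (forall u, (t <= u < n)%N -> L0 P (F u) (K u) (k u)) ->
  {ae P, forall w, \sum_(t <= u < n) k u w = 0} ->
  forall u, (t <= u < n)%N -> {ae P, forall w, k u w = 0}.
Proof.
elim: n => [|n IH] nT kK sum0 u; first by rewrite ltn0 andbF.
have [tn|nt] := leqP t n; last first.
  by rewrite ltnS => /andP[tu un]; have := leq_ltn_trans (leq_trans tu un) nt; rewrite ltnn.
(* [Aset] asks for equality at every outcome, while [k n] equals this sum only almost surely; so [f]
   is tested instead. *)
pose f w := - \sum_(t <= v < n) k v w.
(* [Aset] sums over all dates from 0 to [n]; the missing ones are filled with the zero trade,
   admissible since [K v] contains 0. *)
pose z v w : V := if (t <= v < n)%N then - k v w else 0.
have mk v : (t <= v < n.+1)%N -> Gmeas (F v) (k v) by move=> /kK[].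
have fA : Aset P F K 0 n f.
  exists z; split=> [v /andP[_ vn]|]; last first.
    apply/funext => w; rewrite /f (big_nat_widenl t 0)// (big_nat_widen 0 n n.+1)//.
    rewrite big_mkcond -sumrN; apply: eq_bigr => v _; rewrite /z.
    by case: ifP => _; rewrite ?oppr0.
  have [tvn|tvn] := boolP (t <= v < n)%N; rewrite /z.
    rewrite (_ : (fun w => _) = (fun w => - k v w)); last by apply/funext => w; rewrite tvn.
    have tvn1 : (t <= v < n.+1)%N by case/andP: tvn => -> /ltnW; rewrite ltnS => ->.
    have [kv Kk] := kK _ tvn1; split; first exact: GmeasN.
    by apply: filterS Kk => w; rewrite /negset /= opprK.
  rewrite (_ : (fun w => _) = (fun w => 0)); last first.
    by apply/funext => w; rewrite (negbTE tvn).
  split; first exact: Gmeas_cst.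
  by apply: filterS (K0 (leq_trans vn nT)) => w; rewrite /negset /= oppr0.
have fk : {ae P, forall w, f w = k n w}.
  apply: filterS sum0 => w; rewrite big_nat_recr//= => /eqP.
  by rewrite addr_eq0 => /eqP e; rewrite /f e opprK.
have mf : Gmeas (F n) f.
  apply: GmeasN => //.
  rewrite (_ : (fun w => _) = (fun w => \sum_(v <- index_iota t n | (t <= v < n)%N) k v w)).
    apply: Gmeas_sum => // v /andP[tv vn]; apply: (Gmeas_incr (ltnW vn)).
    by apply: mk; rewrite tv ltnS ltnW.
  by apply/funext => w; rewrite big_nat_cond; apply: eq_bigl => v; rewrite andbT.
have [_ Kkn] := kK n (introT andP (conj tn (leqnn _))).
have fK : L0 P (F n) (K n) f.
  by split=> //; apply: filterS2 fk Kkn => w ->.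
have [_ fKz] := NAs nT (conj fA fK).
have f0 : {ae P, forall w, f w = 0}.
  apply: filterS2 fKz (Kstrict nT) => w fKz KnK.
  have : (K n w `&` negset (K n w)) (f w); last by rewrite KnK.
  split.
    (* The scalars 1 and -1 in [Kzero] place [f w] in [K n w] and in its opposite. *)
    have [|y Ky ->] := fKz 1; first exact: oner_neq0.
    by rewrite rmorph1 scale1r.
  have [|y Ky fy] := fKz (- 1); first by rewrite oppr_eq0 oner_neq0.
  by rewrite /negset /= fy rmorphN1 scaleN1r opprK.
have kn0 : {ae P, forall w, k n w = 0} by apply: filterS2 fk f0 => w <-.
move=> /andP[tu]; rewrite ltnS leq_eqVlt => /predU1P[->//|un].
apply: IH; [exact: ltnW| |by apply: filterS f0 => w /eqP; rewrite oppr_eq0 => /eqP|by rewrite tu].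
by move=> v /andP[tv vn]; apply: kK; rewrite tv ltnS ltnW.
Qed.

(** * Directions that decompose into trades *)

Definition decomposable t (g : Omega -> V) := exists k : nat -> Omega -> V,
  (forall u, (t <= u <= T)%N -> L0 P (F u) (K u) (k u)) /\
  {ae P, forall w, g w = \sum_(t <= u < T.+1) k u w}.

Definition cons_trade t g (k : nat -> Omega -> V) u := if u == t then g else k u.

Lemma cons_trade_L0 t g k : (t < T)%N -> L0 P (F t) (K t) g ->
  (forall u, (t < u <= T)%N -> L0 P (F u) (K u) (k u)) ->
  forall u, (t <= u <= T)%N -> L0 P (F u) (K u) (cons_trade t g k u).
Proof.
move=> tT gK kK u; rewrite /cons_trade; have [->//|ut] := eqVneq u t.
by move=> /andP[tu uT]; apply: kK; rewrite ltn_neqAle eq_sym ut tu.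
Qed.

Lemma cons_trade_sum t g k w : (t < T)%N ->
  \sum_(t <= u < T.+1) cons_trade t g k u w = g w + \sum_(t.+1 <= u < T.+1) k u w.
Proof.
move=> tT; rewrite big_ltn ?ltnS ?(ltnW tT)// {1}/cons_trade eqxx; congr (_ + _).
by apply: eq_big_nat => u /andP[tu _]; rewrite /cons_trade gtn_eqF.
Qed.

Lemma decomposable_cons t g h : (t < T)%N -> L0 P (F t) (K t) g ->
  decomposable t.+1 h -> decomposable t (fun w => g w + h w).
Proof.
move=> tT gK [k [kK hk]]; exists (cons_trade t g k); split.
  exact: cons_trade_L0.
by apply: filterS hk => w ->; rewrite cons_trade_sum.
Qed.

(** The induction invariant that turns geometry into finance: a free direction of a superhedging set
    becomes a sequence of trades, to which no arbitrage applies. *)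
Definition rec_decomposable t (X : Omega -> set V) := forall g, Gmeas (F t) g ->
  {ae P, forall w, reccone (X w) (g w)} -> decomposable t g.

(** * One backward step *)

Section Step.
Variables (t : nat) (X M : Omega -> set V).
Hypotheses (tT : (t < T)%N) (Xrcc : rand_closed_convex_set (F t.+1) X)
  (Xdec : rec_decomposable t.+1 X) (coreM : is_ccore P (F t) X M)
  (vM : forall w, Defs.convex_set (M w)).

Let cK w : closed (K t w). Proof. by case: (Kmeas (ltnW tT)) => -[]. Qed.
Let vK w : Defs.convex_set (K t w). Proof. by case: (Kmeas (ltnW tT)). Qed.
Let mK : hit_measurable (F t) (K t). Proof. by case: (Kmeas (ltnW tT)) => -[]. Qed.
Let cX w : closed (X w). Proof. by case: Xrcc => -[]. Qed.
Let vX w : Defs.convex_set (X w). Proof. by case: Xrcc. Qed.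
Let cM w : closed (M w). Proof. by case: coreM => -[]. Qed.
Let mM : hit_measurable (F t) M. Proof. by case: coreM => -[]. Qed.
Let MX : as_subset P M X. Proof. by case: coreM => _ []. Qed.

Lemma reccone_core_decomposable g : Gmeas (F t) g ->
  {ae P, forall w, reccone (M w) (g w)} -> decomposable t.+1 g.
Proof.
move=> mg Mg; apply: Xdec; first exact: Gmeas_incr mg.
by apply: filterS2 MX Mg => w MXw; exact: reccone_sub.
Qed.

(* A common direction is a trade that can be reversed later at no cost. *)
Lemma no_common_line_ae : {ae P, forall w, no_common_line (K t w) (M w)}.
Proof.
pose N w := reccone (K t w) `&` [set v | reccone (M w) (0 - v)].
have cN2 w : closed [set v | reccone (M w) (0 - v)].
  have := @closed_affine_preimage _ _ _ 0 (- 1) (reccone_closed (@cM w)).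
  by under eq_set do rewrite scaleN1r.
have mN : hit_measurable (F t) N.
  apply: hit_measurable_setI => //.
  - by move=> w; exact: reccone_closed.
  - exact: hit_measurable_reccone.
  - have mR := hit_measurable_reccone (Fsigma t) cM vM mM.
    exact: (hit_measurable_shift (Fsigma t) (Gmeas_cst (Fsigma t) 0) mR).
(* Common directions can be scaled to any length, so norm above 1 detects them. The strict
   inequality keeps [U] open, and its closed form [C] survives the closure in the selection. *)
pose U := [set v : V | 1 < `|v|].
have oU : open U.
  apply: (@open_comp _ _ (fun v : V => `|v|) [set r : R | 1 < r]); last exact: open_gt.
  by move=> v _; exact: norm_continuous.
pose C := [set v : V | 1 <= `|v|].
have cC : closed C.
  apply: (@closed_comp _ _ (fun v : V => `|v|) [set r : R | 1 <= r]); last exact: closed_ge.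
  by move=> v _; exact: norm_continuous.
have mZ := hit_measurable_setIopen oU mN.
have [f [mf Hf]] := measurable_selection (Fsigma t) mZ.
pose A := [set w | N w `&` U !=set0].
have FA : F t A by exact: mN.
pose g w := if w \in A then f w else 0.
have mg : Gmeas (F t) g.
  apply: Gmeas_if => //; last exact: Gmeas_cst.
  exact/Gmeas_hit_measurable.
have gC w : A w -> N w (g w) /\ C (g w).
  move=> Aw; rewrite /g mem_set//; have fZ := Hf _ Aw; split; last first.
    by apply: cC; apply: closureS fZ => v [_ /ltW].
  split; first by apply: (@reccone_closed _ _ (K t w)) => //; apply: closureS fZ => v [[]].
  by apply: cN2; apply: closureS fZ => v [[]].
have gN w : N w (g w).
  have [/gC[]//|Aw] := pselect (A w).
  by rewrite /g memNset//; split; [left|left; rewrite subr0].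
have gK : L0 P (F t) (K t) g.
  split=> //; apply: filterS (K0 (ltnW tT)) => w K0w.
  by apply: reccone_sub_self => //; case: (gN w).
have [k [kK hk]] : decomposable t.+1 (fun w => - g w).
  apply: reccone_core_decomposable; first exact: GmeasN.
  by apply: aeW => w; case: (gN w) => _ /=; rewrite sub0r.
have g0 : {ae P, forall w, g w = 0}.
  have tT1 : (t <= t < T.+1)%N by rewrite leqnn ltnS ltnW.
  (* Trading [g] at [t] and then the decomposition of [- g] sums to zero. *)
  have := zero_sum_trades (leqnn T.+1) (cons_trade_L0 tT gK kK) _ tT1.
  rewrite /cons_trade eqxx; apply.
  by apply: filterS hk => w e; rewrite cons_trade_sum// -e subrr.
apply: filterS g0 => w g0 v Kv Mv; apply: contrapT => /eqP v0.
have nv0 : 0 < `|v| by rewrite normr_gt0.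
have Aw : A w.
  have a0 : 0 <= 2 / `|v| by rewrite divr_ge0.
  exists ((2 / `|v|) *: v); split.
    split; first exact: reccone_scale.
    by rewrite /= sub0r -scalerN; exact: reccone_scale.
  by rewrite /U /= normrZ ger0_norm// divfK ?gt_eqF// ltr1n.
by have [_] := gC w Aw; rewrite /C /= g0 normr0 ler10.
Qed.

Lemma closed_minksum_ae : {ae P, forall w, closed (minksum (K t w) (M w))}.
Proof. by apply: filterS no_common_line_ae => w KM; exact: minksum_closed. Qed.

Lemma minksum_hit_measurable : hit_measurable (F t) (fun w => minksum (K t w) (M w)).
Proof.
apply: (@hit_measurable_eq _ _ _ _ (fun w => [set xy.1 + xy.2 | xy in K t w `*` M w])).
  move=> w; apply/seteqP; split => x; first by case=> -[k m] [/= Kk Mm] <-; exists k => //; exists m.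
  by case=> k Kk [m Mm <-]; exists (k, m).
apply: hit_measurable_image2 => // xy.
by apply: cvgD; [exact: cvg_fst|exact: cvg_snd].
Qed.

(** The trade is a measurable selection of [K t] intersected with [f - M], nonempty almost surely by
    hypothesis. *)
Lemma L0_minksum f : Gmeas (F t) f -> {ae P, forall w, minksum (K t w) (M w) (f w)} ->
  exists k, L0 P (F t) (K t) k /\ {ae P, forall w, M w (f w - k w)}.
Proof.
move=> mf KMf.
have [||k [mk Zk]] := @L0_nonempty _ _ _ _ P _ (Fsigma t) (fun w => K t w `&` [set y | M w (f w - y)]).
- have cM2 w : closed [set y | M w (f w - y)].
    have := @closed_affine_preimage _ _ _ (f w) (- 1) (@cM w).
    by under eq_set do rewrite scaleN1r.
  split; first by move=> w; exact: closedI.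
  by apply: hit_measurable_setI => //; exact: hit_measurable_shift.
- apply: filterS KMf => w [k Kk [m Mm <-]]; exists k; split=> //=.
  by rewrite addrC addKr.
by exists k; split; [split=> //|]; apply: filterS Zk => w [].
Qed.

(** Maximality of the core sends [F t]-measurable selections of [X] into [M]; conversely, measurable
    splitting recovers them from the sum. *)
Lemma L0_minksumE :
  fsum (L0 P (F t) (K t)) (L0 P (F t.+1) X `&` L0 P (F t) (fun=> setT)) =
  L0 P (F t) (fun w => minksum (K t w) (M w)).
Proof.
apply/seteqP; split => f.
  move=> [k [mk Kk] [h [[_ Xh] [mh _]] ->]]; split; first exact: GmeasD.
  have Mh := ccore_selection (Fsigma t) coreM mh Xh.
  by apply: filterS2 Kk Mh => w Kk Mh; exists (k w) => //; exists (h w).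
move=> [mf KMf]; have [k [Kk Mfk]] := L0_minksum mf KMf.
have mk : Gmeas (F t) k by case: Kk.
have mfk := GmeasB (Fsigma t) mf mk.
exists k => //; exists (fun w => f w - k w); last first.
  by apply/funext => w; rewrite addrC subrK.
split; split => //; last exact: aeW.
  exact: Gmeas_incr mfk.
by apply: filterS2 MX Mfk => w; exact.
Qed.

(** The split of a recession direction is chosen measurably: its part in [K t] is the trade at [t],
    and its part in [M] is also a direction of [X], decomposed from [t.+1] on. *)
Lemma minksum_rec_decomposable : rec_decomposable t (fun w => minksum (K t w) (M w)).
Proof.
move=> g mg gKM.
have [||k [mk Zk]] := @L0_nonempty _ _ _ _ P _ (Fsigma t)
  (fun w => reccone (K t w) `&` [set y | reccone (M w) (g w - y)]).
- have cM2 w : closed [set y | reccone (M w) (g w - y)].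
    have := @closed_affine_preimage _ _ _ (g w) (- 1) (reccone_closed (@cM w)).
    by under eq_set do rewrite scaleN1r.
  split; first by move=> w; apply: closedI => //; exact: reccone_closed.
  apply: hit_measurable_setI => //; first by move=> w; exact: reccone_closed.
    exact: hit_measurable_reccone.
  have mR := hit_measurable_reccone (Fsigma t) cM vM mM.
  exact: (hit_measurable_shift (Fsigma t) mg mR).
- apply: filterS2 no_common_line_ae gKM => w KM gKM.
  by have [k [Kk Mk]] := reccone_minksum (@cK w) (@vK w) (@cM w) (@vM w) KM gKM; exists k.
have -> : g = (fun w => k w + (g w - k w)) by apply/funext => w; rewrite addrC subrK.
apply: decomposable_cons => //.
  split=> //; apply: filterS2 (K0 (ltnW tT)) Zk => w K0w [Kk _].
  exact: reccone_sub_self.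
apply: reccone_core_decomposable; first exact: GmeasB.
by apply: filterS Zk => w [].
Qed.

End Step.

(** * Terminal date and backward recursion *)

Lemma terminal_rec_decomposable :
  rec_decomposable T (fun w => [set xi w + k | k in K T w]).
Proof.
move=> g mg gX; exists (fun=> g); split=> [u|]; last first.
  by apply: aeW => w; rewrite big_nat1.
rewrite -eqn_leq => /eqP <-; split=> //.
apply: filterS2 gX (K0 (leqnn T)) => w [->//|[_ gX]] K0w.
(* As 0 is in [K T w], the point [xi w] is in the set, and one unit along [g w] shows that [g w] is
   itself a terminal trade. *)
have [|k Kk] := gX (xi w) 1 _ ler01; first by exists 0; rewrite ?addr0.
by rewrite scale1r => /addrI <-.
Qed.

Lemma terminal_rand_closed_convex : Gmeas (F T) xi ->
  rand_closed_convex_set (F T) (fun w => [set xi w + k | k in K T w]).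
Proof.
move=> /(Gmeas_hit_measurable (Fsigma T)) mxi.
have [[cK mK] vK] := Kmeas (leqnn T).
have KE w : [set xi w + k | k in K T w] = [set x | K T w (- xi w + 1 *: x)].
  apply/seteqP; split => x /=; first by case=> k Kk <-; rewrite scale1r addKr.
  by rewrite scale1r => Kx; exists (- xi w + x); rewrite ?addNKr.
split; first split.
- by move=> w; rewrite KE; exact: closed_affine_preimage.
- apply: (@hit_measurable_eq _ _ _ _ (fun w => [set xy.1 + xy.2 | xy in [set xi w] `*` K T w])).
    move=> w; apply/seteqP; split => x; first by case=> -[_ k] [/= -> Kk] <-; exists k.
    by case=> k Kk <-; exists (xi w, k).
  apply: hit_measurable_image2 => // xy.
  by apply: cvgD; [exact: cvg_fst|exact: cvg_snd].
- move=> w _ _ l [x Kx <-] [y Ky <-] l0 l1; exists (l *: x + (1 - l) *: y); first exact: vK.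
  by rewrite !scalerDr addrACA -scalerDl (addrC l) subrK scale1r.
Qed.

Definition convex_ccore G (X : Omega -> set V) : Omega -> set V :=
  xget (fun=> set0) [set M | is_ccore P G X M /\ forall w, Defs.convex_set (M w)].

(* [hedge k] is the superhedging set at time [T - k]; the sum is closed and
   convex almost surely, and is reset to the empty set elsewhere. *)
Fixpoint hedge (k : nat) : Omega -> set V :=
  if k is k'.+1 then
    fun w => let S := minksum (K (T - k)%N w) (convex_ccore (F (T - k)%N) (hedge k') w) in
      if `[< closed S /\ Defs.convex_set S >] then S else set0
  else fun w => [set xi w + k | k in K T w].

Definition hedge_spec k := [/\ rand_closed_convex_set (F (T - k)%N) (hedge k),
  rec_decomposable (T - k)%N (hedge k) &
  Xi_rev P F K T xi k = L0 P (F (T - k)%N) (hedge k)].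

Lemma L0_ae (G : set (set Omega)) (X Y : Omega -> set V) :
  {ae P, forall w, X w = Y w} -> L0 P G X = L0 P G Y.
Proof.
by move=> XY; apply/seteqP; split => f [mf Xf]; split=> //; apply: filterS2 XY Xf => w ->.
Qed.

Lemma hedge_step k : (k < T)%N -> hedge_spec k ->
  hedge_spec k.+1 /\ exists M, is_ccore P (F (T - k.+1)%N) (hedge k) M /\
    {ae P, forall w, hedge k.+1 w = minksum (K (T - k.+1)%N w) (M w)}.
Proof.
move=> kT [Xrcc Xdec XiE]; set t := (T - k.+1)%N.
have tk : (T - k)%N = t.+1 by rewrite /t subnSK.
have tT : (t < T)%N by rewrite /t ltn_subrL (leq_ltn_trans _ kT).
rewrite tk in Xrcc Xdec XiE.
pose M := convex_ccore (F t) (hedge k).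
have [coreM vM] : is_ccore P (F t) (hedge k) M /\ forall w, Defs.convex_set (M w).
  have [M0 HM0] : exists M, is_ccore P (F t) (hedge k) M /\ forall w, Defs.convex_set (M w).
    by case: Xrcc => -[cX _] vX; apply: convex_ccore_exists => //; [exact: Fnegl|exact: Fsub].
  exact: (@xgetPex _ (fun=> set0) [set M | is_ccore P (F t) (hedge k) M /\
    forall w, Defs.convex_set (M w)] (ex_intro _ M0 HM0)).
have vS w : Defs.convex_set (minksum (K t w) (M w)).
  by have [_ vK] := Kmeas (ltnW tT); exact: minksum_convex.
have SE : {ae P, forall w, minksum (K t w) (M w) = hedge k.+1 w}.
  apply: filterS (closed_minksum_ae tT Xrcc Xdec coreM vM) => w cS.
  by rewrite /= asboolT.
split; last by exists M; split=> //; apply: filterS SE.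
split.
- split; first split.
  + by move=> w /=; case: asboolP => [[]//|_]; exact: closed0.
  (* The reset to the empty set changes [S] on a negligible event only, and [F t] contains all such
     events. *)
  + exact: (hit_measurable_ae (Fsigma t) (@Fnegl t) SE (minksum_hit_measurable tT coreM)).
  + by move=> w /=; case: asboolP => [[]//|_ x y l].
- move=> g mg gX; apply: (minksum_rec_decomposable tT Xrcc Xdec coreM vM mg).
  by apply: filterS2 SE gX => w ->.
- by rewrite /= -/t XiE (L0_minksumE tT coreM) (L0_ae _ SE).
Qed.

Lemma hedge_specP k : Gmeas (F T) xi -> (k <= T)%N -> hedge_spec k.
Proof.
move=> mxi; elim: k => [_|k IH kT]; last by case: (hedge_step kT (IH (ltnW kT))).
rewrite /hedge_spec subn0; split=> //; first exact: terminal_rand_closed_convex.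
exact: terminal_rec_decomposable.
Qed.

End Superhedging.

Theorem theorem7p3 (dsp : measure_display) (Omega : measurableType dsp)
  (R : realType) (P : probability Omega R) (d T : nat)
  (F : nat -> set (set Omega)) (K : nat -> Omega -> set 'rV[R]_d)
  (xi : Omega -> 'rV[R]_d)
  (* complete probability space *)
  (Pcomplete : forall N A : set Omega, measurable N -> P N = 0%E -> A `<=` N -> measurable A)
  (* filtration of sub-sigma-algebras containing the null sets *)
  (Fsigma : forall t, sigma_algebra setT (F t))
  (Fsub : forall t (A : set Omega), F t A -> measurable A)
  (Fnull : forall t (N : set Omega), measurable N -> P N = 0%E -> F t N)
  (Fincr : forall s t, (s <= t)%N -> forall A, F s A -> F t A)
  (F0triv : forall A, F 0%N A -> P A = 0%E \/ P A = 1%E)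
  (* solvency sets *)
  (Kmeas : forall t, (t <= T)%N -> rand_closed_convex_set (F t) (K t))
  (Kplus : forall t, (t <= T)%N ->
     {ae P, forall w, minksum (K t w) (@nonneg_orthant R d) `<=` K t w})
  (Kneg : forall t, (t <= T)%N ->
     {ae P, forall w, K t w `&` @nonpos_orthant R d = [set 0]})
  (* strictly proper *)
  (Kstrict : forall t, (t <= T)%N ->
     {ae P, forall w, K t w `&` negset (K t w) = [set 0]})
  (* (NA^s) *)
  (NAs : forall t, (t <= T)%N ->
     Aset P F K 0 t `&` L0 P (F t) (K t) `<=` L0 P (F t) (fun w => Kzero (K t w)))
  (xi_meas : Gmeas (F T) xi) :
  exists X : nat -> Omega -> set 'rV[R]_d,
    (forall t, (t <= T)%N -> rand_closed_convex_set (F t) (X t)) /\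
    (forall w, X T w = [set xi w + k | k in K T w]) /\
    (forall t, (t < T)%N -> exists M : Omega -> set 'rV[R]_d,
        is_ccore P (F t) (X t.+1) M /\
        {ae P, forall w, X t w = minksum (K t w) (M w)}) /\
    (forall t, (t <= T)%N -> Xi P F K T xi t = L0 P (F t) (X t)).
Proof.
(* Completeness extends the null-set hypothesis from measurable null sets to all their subsets. *)
have Fnegl t (N : set Omega) : P.-negligible N -> F t N.
  move=> [A [mA PA NA]]; have mN := Pcomplete _ _ mA PA NA; apply: Fnull => //.
  by apply/eqP; rewrite -measure_le0 -PA le_measure// inE.
have K0 t : (t <= T)%N -> {ae P, forall w, K t w 0}.
  move=> /Kneg; apply: filterS => w KE.
  by have [] : (K t w `&` @nonpos_orthant R d) 0 by rewrite KE.
pose X t := hedge P T F K xi (T - t).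
have spec k := hedge_specP Fsigma Fsub Fnegl Fincr Kmeas K0 Kstrict NAs (k := k) xi_meas.
exists X; split; [|split; [|split]].
- move=> t tT; have [] := spec (T - t)%N (leq_subr _ _).
  by rewrite subKn.
- by move=> w; rewrite /X subnn.
- move=> t tT; have kT : (T - t.+1 < T)%N by rewrite ltn_subrL (leq_ltn_trans _ tT).
  have := hedge_step Fsigma Fsub Fnegl Fincr Kmeas K0 Kstrict NAs kT (spec _ (ltnW kT)).
  by rewrite subnSK// subKn 1?ltnW// => -[_ [M [coreM XE]]]; exists M.
- move=> t tT; have [_ _] := spec (T - t)%N (leq_subr _ _).
  by rewrite subKn.
Qed.
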